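(* LxCIM is LxC-invariant: for every $N\ge 1$, every dataset $\{(s_i,y_i,w_i)\}_{i=1}^N$ with $s_i\in\mathbb{R}$, $y_i\in\{0,1\}$, $w_i>0$, and every subset $I\subseteq\{1,\dots,N\}$, $$\mathrm{LxCIM}\Bigl(\{A(s_i,y_i,w_i)\}_{i\in I}\cup\{(s_j,y_j,w_j)\}_{j\notin I}\Bigr)=\mathrm{LxCIM}\Bigl(\{(s_i,y_i,w_i)\}_{i=1}^N\Bigr),$$ where in the dataset on the left each sample keeps its index.
   Context: Decision function: $g:\mathbb{R}\to\mathbb{R}$ is a fixed function with a point $s^*\in\mathbb{R}$ such that $g$ is strictly decreasing for $s<s^*$, strictly increasing for $s>s^*$, attains its global minimum at $s^*$, satisfies $g^{-1}(\{g(s^* )\})=\{s^*\}$, and for every $s\ne s^*$ satisfies $g^{-1}(\{g(s)\})=\{s,s'\}$ for exactly one $s'\neq s$ (which then lies on the other side of $s^*$). A dataset is an indexed family of triples $(s_i,y_i,w_i)$, $i=1,\dots,N$ (score, true label in $\{0,1\}$, positive weight). Prediction function: $u(s)=1$ if $s>s^*$, and $u(s)=0$ otherwise. Exchange map: $A(s,y,w)=(s^*,y,w)$ if $s=s^*$, and $A(s,y,w)=(s',1-y,w)$ if $s\ne s^*$, where $\{s,s'\}=g^{-1}(\{g(s)\})$, $s'\ne s$. LxCIM: let $\pi$ be the permutation of $\{1,\dots,N\}$ with $g(s_{\pi(1)})\ge g(s_{\pi(2)})\ge\dots\ge g(s_{\pi(N)})$, ties being broken by a fixed rule depending only on the indices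 (e.g. increasing index). Let $W=\sum_{k=1}^N w_k$. For $t\in(0,W]$ let $j(t)=\pi(k)$, where $k$ is the unique index with $\sum_{l=1}^{k-1}w_{\pi(l)}<t\le\sum_{l=1}^{k}w_{\pi(l)}$. Define the cumulative accuracy $$G(t)=\frac1W\int_0^t \mathbb{I}\bigl[u(s_{j(r)})=y_{j(r)}\bigr]\,dr,\qquad 0\le t\le W,$$ and $$\mathrm{LxCIM}\bigl(\{(s_i,y_i,w_i)\}_{i=1}^N\bigr)=\frac{2}{W}\int_0^W G(t)\,dt .$$ *)

(* Defs.v *)
From mathcomp Require Import all_boot all_order all_algebra.
From mathcomp Require Import all_classical all_reals all_analysis.

Set Implicit Arguments.
Unset Strict Implicit.
Unset Printing Implicit Defensive.

Import Order.TTheory GRing.Theory Num.Theory.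

Local Open Scope classical_set_scope.
Local Open Scope ring_scope.

(* The fact that [s'] lies on the other side of [sstar] is not assumed: it
   follows from strict monotonicity on each side. *)
Record decision_function (R : realType) (g : R -> R) (sstar : R) : Prop := {
  decision_decr : forall s t, s < t -> t < sstar -> g t < g s;
  decision_incr : forall s t, sstar < s -> s < t -> g s < g t;
  decision_min : forall s, g sstar <= g s;
  decision_fiber_min : g @^-1` [set g sstar] = [set sstar];
  decision_fiber : forall s, s != sstar ->
    exists! s', s' != s /\ g @^-1` [set g s] = [set s; s']
}.

(* Labels are booleans: 1 is [true], 0 is [false], so 1 - y is [~~ y]. *)
Record sample (R : realType) := Sample {
  score : R;
  label : bool;
  weight : R
}.

Section LxCIM.
Variables (R : realType) (g : R -> R) (sstar : R).

Definition prediction (s : R) : bool := sstar < s.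

(* The default value [s] of [xget] is never reached when [g] is a decision
   function and [s != sstar]. *)
Definition conjugate_score (s : R) : R :=
  xget s [set s' | s' != s /\ g @^-1` [set g s] = [set s; s']].

Definition exchange (x : sample R) : sample R :=
  if score x == sstar then Sample sstar (label x) (weight x)
  else Sample (conjugate_score (score x)) (~~ label x) (weight x).

Definition exchange_on (N : nat) (I : {set 'I_N}) (D : 'I_N -> sample R) :
    'I_N -> sample R :=
  fun i => if i \in I then exchange (D i) else D i.

(* [tie i j] is the tie-breaking rule: among samples of equal [g (score _)],
   [i] is ranked no later than [j].  It is meant to be a total order on the
   indices, in which case the sorted sequence below is unique. *)
Variables (N : nat) (tie : rel 'I_N) (D : 'I_N -> sample R).

Definition rank_le (i j : 'I_N) : bool :=
  (g (score (D j)) < g (score (D i))) ||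
  ((g (score (D i)) == g (score (D j))) && tie i j).

Definition ranking (k : 'I_N) : 'I_N :=
  tnth [tuple of sort rank_le (ord_tuple N)] k.

Definition total_weight : R := \sum_(k < N) weight (D k).

(* With positive weights this is [Some _] exactly when 0 < t <= W, and then
   at most one [k] satisfies the condition. *)
Definition sample_at (t : R) : option 'I_N :=
  omap ranking
    [pick k : 'I_N |
      (\sum_(l < N | (l < k)%N) weight (D (ranking l)) < t) &&
      (t <= \sum_(l < N | (l <= k)%N) weight (D (ranking l)))].

Definition correct (i : 'I_N) : bool :=
  prediction (score (D i)) == label (D i).

Definition correct_at (t : R) : bool :=
  if sample_at t is Some i then correct i else false.

Definition cumulative_accuracy (t : R) : R :=
  total_weight^-1 *
  \int[lebesgue_measure]_(r in `]0, t]) (correct_at r)%:R.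

Definition lxcim : R :=
  2 / total_weight *
  \int[lebesgue_measure]_(t in `[0, total_weight]) cumulative_accuracy t.

End LxCIM.

(* Main.v *)
Require Import Defs.
From mathcomp Require Import all_boot all_order all_algebra.
From mathcomp Require Import all_classical all_reals all_analysis.

(** LxCIM sees a dataset only through the values [g (score _)], the weights and
    the correctness of the predictions.  The exchange map preserves all three:
    the conjugate score lies on the other side of [sstar], so the prediction
    and the label flip together. *)

Set Implicit Arguments.
Unset Strict Implicit.
Unset Printing Implicit Defensive.

Import Order.TTheory GRing.Theory Num.Theory.

Local Open Scope classical_set_scope.
Local Open Scope ring_scope.

(** The two datasets induce the same relation [rank_le], hence the same sorted sequence; everything
    built on it then agrees as a function, so no integral has to be evaluated. *)
Lemma eq_lxcim (R : realType) (g : R -> R) (sstar : R) (N : nat)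
    (tie : rel 'I_N) (D D' : 'I_N -> sample R) :
  (forall i, g (score (D i)) = g (score (D' i))) ->
  (forall i, weight (D i) = weight (D' i)) ->
  correct sstar D =1 correct sstar D' ->
  lxcim g sstar tie D = lxcim g sstar tie D'.
Proof.
move=> eqg eqw eqc.
have eq_rank : ranking g tie D = ranking g tie D'.
  have eq_le : rank_le g tie D = rank_le g tie D'.
    by apply/funext => i; apply/funext => j; rewrite /rank_le !eqg.
  by rewrite /ranking eq_le.
have eqW : total_weight D = total_weight D' by apply: eq_bigr.
have eq_at : sample_at g tie D = sample_at g tie D'.
  apply/funext => t; rewrite /sample_at eq_rank; congr omap.
  (* With the rankings identified, the bounds on [t] differ only through the weights. *)
  apply: eq_pick => k /=.
  by congr (_ && _); [congr (_ < t)|congr (t <= _)]; apply: eq_bigr.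
have eq_correct_at : correct_at g sstar tie D = correct_at g sstar tie D'.
  by apply/funext => t; rewrite /correct_at eq_at; case: sample_at.
by rewrite /lxcim /cumulative_accuracy eqW eq_correct_at.
Qed.

Section Exchange.
Variables (R : realType) (g : R -> R) (sstar : R).
Hypothesis hg : decision_function g sstar.

(** The fiber condition provides a member of the set, so [xget] does not fall back on its default
    [s]. *)
Lemma conjugate_scoreP (s : R) : s != sstar ->
  conjugate_score g s != s /\
  g @^-1` [set g s] = [set s; conjugate_score g s].
Proof.
move=> /(decision_fiber hg) [s' [s'P _]].
have := @xgetPex R s [set t | t != s /\ g @^-1` [set g s] = [set s; t]].
by apply; exists s'.
Qed.

Lemma conjugate_score_fiber (s : R) : s != sstar ->
  g (conjugate_score g s) = g s.
Proof.
move=> /conjugate_scoreP[_ fibE].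
suff : (g @^-1` [set g s]) (conjugate_score g s) by [].
by rewrite fibE; right.
Qed.

(** Strict monotonicity makes [g] injective on each open side of [sstar], and the minimum is
    attained only at [sstar]. *)
Lemma decision_fiber_opposite (s t : R) : s != t -> g s = g t ->
  prediction sstar t = ~~ prediction sstar s.
Proof.
have min_inj x : g x = g sstar -> x = sstar.
  move=> gx; suff : (g @^-1` [set g sstar]) x by rewrite (decision_fiber_min hg).
  by [].
(* The conclusion is symmetric in [s] and [t], negation being an involution. *)
wlog lt_st : s t / s < t => [wlog_lt st gst|_ gst].
  have [lt_st|lt_ts|eq_st] := ltgtP s t; first exact: wlog_lt.
    by rewrite (wlog_lt t s) ?negbK // eq_sym.
  by rewrite eq_st eqxx in st.
rewrite /prediction; case: (ltgtP sstar s) => [lt_s|lt_s|eq_s].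
- by have := decision_incr hg lt_s lt_st; rewrite gst ltxx.
- have [//|lt_t|eq_t] := ltgtP sstar t.
    by have := decision_decr hg lt_st lt_t; rewrite gst ltxx.
  (* If [t = sstar], then [s] also attains the minimum, against [s < sstar]. *)
  by move: lt_s; rewrite (min_inj s) ?ltxx // gst eq_t.
- by rewrite eq_s.
Qed.

Lemma exchange_score (x : sample R) :
  g (score (exchange g sstar x)) = g (score x).
Proof.
rewrite /exchange; case: (eqVneq (score x) sstar) => [->//|s_neq] /=.
exact: conjugate_score_fiber.
Qed.

Lemma exchange_weight (x : sample R) :
  weight (exchange g sstar x) = weight x.
Proof. by rewrite /exchange; case: ifP. Qed.

Lemma exchange_correct (x : sample R) :
  (prediction sstar (score (exchange g sstar x)) ==
    label (exchange g sstar x)) =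
  (prediction sstar (score x) == label x).
Proof.
rewrite /exchange; case: (eqVneq (score x) sstar) => [->//|s_neq] /=.
have [neq_c _] := conjugate_scoreP s_neq.
rewrite (decision_fiber_opposite (s := score x)) ?conjugate_score_fiber //.
  (* Prediction and label are both negated, which preserves whether they agree. *)
  by rewrite (inj_eq negb_inj).
by rewrite eq_sym.
Qed.

End Exchange.

Theorem mainTheorem2 (R : realType) (g : R -> R) (sstar : R)
    (hg : decision_function g sstar)
    (N : nat) (hN : (1 <= N)%N)
    (tie : rel 'I_N)
    (tie_total : total tie) (tie_trans : transitive tie)
    (tie_anti : antisymmetric tie)
    (D : 'I_N -> sample R) (hw : forall i, 0 < weight (D i))
    (I : {set 'I_N}) :
  lxcim g sstar tie (exchange_on g sstar I D) = lxcim g sstar tie D.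
Proof.
(* The comparison is made index by index; outside [I] the sample is unchanged. *)
apply: eq_lxcim => i; rewrite /correct /exchange_on; case: ifP => // _.
- exact: exchange_score.
- exact: exchange_weight.
- exact: exchange_correct.
Qed.
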